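(* Let $n\ge1$, let $r_{\max}(n):=\left\lfloor(\sqrt{1+8n}-1)/2\right\rfloor$, and let $C_n$ be an extreme point of the elliptope $\mathcal{E}_n$ with $\mathrm{rank}(C_n)=r_{\max}(n)$. Then $$\mathcal{D}(\mathbf{p}_{C_n})\ge\sqrt{2}^{\,\lfloor r_{\max}(n)/2\rfloor}.$$
   Context: $\mathcal{E}_n:=\{X\in\mathcal{S}^n_+: X_{ii}=1\ \forall i\}$ (real symmetric psd matrices with unit diagonal). For a matrix $C=(c_{xy})\in\mathcal{E}_n$ (which has entries in $[-1,1]$), $\mathbf{p}_C$ is the behavior in the $(n,n,2,2)$-scenario with outcomes $a,b\in\{\pm1\}$ given by $p_C(ab|xy)=\frac{1+ab\,c_{xy}}{4}$; it is a quantum behavior. A behavior $\mathbf{p}$ has a $d$-dimensional quantum representation if there exist a Hermitian psd trace-one $\rho$ on $\mathbb{C}^d\otimes\mathbb{C}^d$ and, for each $x$, Hermitian psd $d\times d$ matrices $\{M_{a|x}\}_a$ summing to $I_d$ and, for each $y$, Hermitian psd $d\times d$ matrices $\{N_{b|y}\}_b$ summing to $I_d$, with $p(ab|xy)=\mathrm{Tr}((M_{a|x}\otimes N_{b|y})\rho)$ for all $a,b,x,y$; $\mathcal{D}(\mathbf{p})$ is the least such $d$. *)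

(* Defs.v *)
From HB Require Import structures.
From mathcomp Require Import all_boot all_order all_algebra.
From mathcomp Require Import complex mxtens.
From mathcomp Require Import reals.
Set Implicit Arguments. Unset Strict Implicit. Unset Printing Implicit Defensive.
Import Order.TTheory GRing.Theory Num.Theory.
Local Open Scope ring_scope.

Section Elliptope.
Variable R : realType.

Definition psd_real n (X : 'M[R]_n) : Prop :=
  X^T = X /\ forall v : 'cV[R]_n, 0 <= (v^T *m X *m v) 0 0.

Definition elliptope n (X : 'M[R]_n) : Prop :=
  psd_real X /\ forall i, X i i = 1.

Definition extreme_elliptope n (C : 'M[R]_n) : Prop :=
  elliptope C /\
  forall (A B : 'M[R]_n) (t : R), elliptope A -> elliptope B ->
    0 < t -> t < 1 -> C = t *: A + (1 - t) *: B -> A = C /\ B = C.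

Definition rmax (n : nat) : nat :=
  `| Num.floor ((Num.sqrt (1 + 8 * n%:R) - 1) / 2 : R) |%N.

(* outcomes a,b in {+1,-1} are encoded by booleans: sgn false = 1, sgn true = -1 *)
Definition sgn (a : bool) : R := (-1) ^+ a.

Definition behavior n := bool -> bool -> 'I_n -> 'I_n -> R.

Definition pC n (C : 'M[R]_n) : behavior n :=
  fun a b x y => (1 + sgn a * sgn b * C x y) / 4.

Local Notation C := (R[i]).

Definition ctrmx m k (A : 'M[C]_(m, k)) : 'M[C]_(k, m) :=
  (map_mx (@conjc R) A)^T.

Definition herm_psd d (A : 'M[C]_d) : Prop :=
  ctrmx A = A /\ forall v : 'cV[C]_d, 0 <= (ctrmx v *m A *m v) 0 0.

Definition has_qrep n (p : behavior n) (d : nat) : Prop :=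
  exists (rho : 'M[C]_(d * d)) (M N : 'I_n -> bool -> 'M[C]_d),
    [/\ herm_psd rho /\ \tr rho = 1,
        (forall x a, herm_psd (M x a)) /\ (forall x, M x false + M x true = 1%:M),
        (forall y b, herm_psd (N y b)) /\ (forall y, N y false + N y true = 1%:M) &
        forall a b x y, \tr ((M x a *t N y b) *m rho) = ((p a b x y)%:C)%C ].

End Elliptope.

(* Main.v *)
Require Import Defs.
From HB Require Import structures.
From mathcomp Require Import all_boot all_order all_algebra.
From mathcomp Require Import complex mxtens.
From mathcomp Require Import ring lra.
From mathcomp Require Import boolp reals.
Set Implicit Arguments. Unset Strict Implicit. Unset Printing Implicit Defensive.
Import Order.TTheory GRing.Theory Num.Theory.
Local Open Scope ring_scope.

(* Write r = rank C, C = W^T W with W of size r x n and columns w_x.  In a quantum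
   representation with observables A_x, B_y, put u_x = A_x (x) I, v_y = I (x) B_y; then
   tr((u_x - v_x)^2 rho) + tr((1 - u_x^2) rho) + tr((1 - v_x^2) rho) = 2 - 2 c_xx = 0
   is a sum of nonnegative terms, so rho u_x = rho v_x and rho u_x^2 = rho.
   Linear extension w_x |-> u_x gives operators U_1, ..., U_r (modulo the left kernel of
   rho).  Because rho u_x = rho v_x and the u's commute with the v's, the quadratic
   form rho U(w)^2 - |w|^2 rho vanishes at every w_x; extremality of C says
   precisely that the w_x w_x^T span the symmetric matrices, so the U_i satisfy the
   Clifford relations on the row space of rho.  The right module
   generated by rho under I (x) M_d is U-stable and still satisfies these relations,
   so its dimension, at most d^2, is at least 2^floor(r/2). *)

(** * Dimension of Clifford modules *)

(** The relations are assumed only after multiplication by [S], so the module is the row space of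
    [S]. Each induction step uses up two generators and passes to a submodule of at most half the
    dimension. *)
Lemma clifford_rank (F : numClosedFieldType) (D m : nat) (U : nat -> 'M[F]_D)
    (S : 'M[F]_D) :
  S != 0 ->
  (forall i, (i < m.*2)%N -> (S *m U i <= S)%MS) ->
  (forall i j, (i < m.*2)%N -> (j < m.*2)%N ->
     S *m (U i *m U j + U j *m U i) = (2 * (i == j)%:R) *: S) ->
  (2 ^ m <= \rank S)%N.
Proof.
elim: m U S => [|m IHm] U S S0 stabS relS; first by rewrite expn0 lt0n mxrank_eq0.
have n2 : (2 : F) != 0 by rewrite pnatr_eq0.
have sqr k (T : 'M_(k, D)) i : (i < m.+1.*2)%N -> (T <= S)%MS ->
    T *m U i *m U i = T.
  move=> im /submxP[Z ->]; have := relS i i im im.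
  rewrite eqxx mulr1 -mulr2n -scaler_nat -scalemxAr => /(scalerI n2) E.
  by rewrite -!mulmxA E.
have anti k (T : 'M_(k, D)) i j : (i < m.+1.*2)%N -> (j < m.+1.*2)%N -> i != j ->
    (T <= S)%MS -> T *m U i *m U j = - (T *m U j *m U i).
  move=> im jm /negbTE nij /submxP[Z ->]; have := relS i j im jm.
  rewrite nij mulr0 scale0r mulmxDr => /eqP; rewrite addr_eq0 => /eqP E.
  by rewrite -!mulmxA E mulmxN.
have stab k (T : 'M_(k, D)) i : (i < m.+1.*2)%N -> (T <= S)%MS ->
    (T *m U i <= S)%MS.
  by move=> im TS; apply: submx_trans (stabS i im); apply: submxMr.
have i0 : (0 < m.+1.*2)%N by [].
have i1 : (1 < m.+1.*2)%N by rewrite doubleS.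
(* [P] squares to 1 on [S], anticommutes with [U 0] and commutes with the other
   generators: [U 0] swaps its eigenspaces [Sp] and [Sm], the others preserve them. *)
pose P := 'i *: (U 0%N *m U 1%N).
have TP k (T : 'M_(k, D)) : T *m P = 'i *: (T *m U 0%N *m U 1%N).
  by rewrite /P -scalemxAr mulmxA.
have stabP k (T : 'M_(k, D)) : (T <= S)%MS -> (T *m P <= S)%MS.
  by move=> TS; rewrite TP scalemx_sub ?stab.
have PP k (T : 'M_(k, D)) : (T <= S)%MS -> T *m P *m P = T.
  move=> TS; rewrite !TP -!scalemxAl scalerA -expr2 sqrCi scaleN1r.
  by rewrite (anti _ (T *m U 0%N) 1%N 0%N) ?stab // mulNmx opprK !sqr.
have P0 k (T : 'M_(k, D)) : (T <= S)%MS -> T *m P *m U 0%N = - (T *m U 0%N *m P).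
  move=> TS; rewrite !TP -!scalemxAl -scalerN; congr (_ *: _).
  by rewrite (anti _ (T *m _)) ?stab.
have P2 k (T : 'M_(k, D)) j : (j < m.*2)%N -> (T <= S)%MS ->
    T *m P *m U j.+2 = T *m U j.+2 *m P.
  move=> jm TS; have jm2 : (j.+2 < m.+1.*2)%N by rewrite doubleS.
  rewrite !TP -!scalemxAl; congr (_ *: _).
  by rewrite (anti _ (T *m _)) ?stab // (anti _ T _ j.+2) // mulNmx opprK.
pose Sp := S + S *m P; pose Sm := S - S *m P.
have SpS : (Sp <= S)%MS by rewrite addmx_sub ?stabP.
have SmS : (Sm <= S)%MS by rewrite addmx_sub ?eqmx_opp ?stabP.
have SpP : Sp *m P = Sp by rewrite mulmxDl PP // addrC.
have SmP : Sm *m P = - Sm by rewrite mulmxBl PP // opprB.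
have SpU : (Sp *m U 0%N <= Sm)%MS.
  rewrite mulmxDl P0 //; have /submxP[Z EZ] := stabS _ i0.
  by rewrite EZ -mulmxA -mulmxBr submxMl.
have SmU : (Sm *m U 0%N <= Sp)%MS.
  rewrite mulmxBl P0 // opprK; have /submxP[Z EZ] := stabS _ i0.
  by rewrite EZ -mulmxA -mulmxDr submxMl.
(* [U 0] squares to 1 on [S], so it is injective on both eigenspaces. *)
have eqr : \rank Sp = \rank Sm.
  have le (A B : 'M_D) : (A <= S)%MS -> (A *m U 0%N <= B)%MS -> (\rank A <= \rank B)%N.
    move=> AS /mxrankS; apply: leq_trans.
    by rewrite -{1}(sqr _ A 0%N i0 AS) mxrankM_maxl.
  by apply/eqP; rewrite eqn_leq !le.
have Sp0 : Sp != 0.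
  apply: contra S0 => /eqP Sp0; move: eqr; rewrite Sp0 mxrank0.
  move/esym/eqP; rewrite mxrank_eq0 => /eqP Sm0.
  have : Sp + Sm = 2 *: S by rewrite /Sp /Sm addrACA subrr addr0 -mulr2n scaler_nat.
  by rewrite Sp0 Sm0 addr0 => /esym/eqP; rewrite scaler_eq0 (negbTE n2).
(* A vector in both eigenspaces is at once fixed and negated by [P]. *)
have cap0 : (Sp :&: Sm = 0)%MS.
  set W := (Sp :&: Sm)%MS.
  have /submxP[Z1 E1] : (W <= Sp)%MS by apply: capmxSl.
  have /submxP[Z2 E2] : (W <= Sm)%MS by apply: capmxSr.
  have : W *m P = - W by rewrite E2 -mulmxA SmP mulmxN.
  rewrite {1}E1 -mulmxA SpP -E1 => /eqP; rewrite -addr_eq0 -mulr2n -scaler_nat.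
  by rewrite scaler_eq0 (negbTE n2) => /eqP.
have rkS : (\rank Sp + \rank Sm <= \rank S)%N.
  by rewrite -mxrank_disjoint_sum // mxrankS // addsmx_sub SpS SmS.
apply: leq_trans rkS; rewrite -eqr addnn -mul2n expnS leq_mul2l /=.
apply: (IHm (fun i => U i.+2)) => // [i im|i j im jm].
  rewrite mulmxDl P2 //.
  have im2 : (i.+2 < m.+1.*2)%N by rewrite doubleS.
  have /submxP[Z EZ] := stabS _ im2.
  by rewrite EZ -mulmxA -mulmxDr submxMl.
have /submxP[Z ->] := SpS.
by rewrite -mulmxA relS ?doubleS // -scalemxAr.
Qed.

(** * Gram factorization of psd matrices, real and complex at once *)

Section PsdFactorization.

(* [sigma] is the identity for real matrices and the conjugation for complex ones. *)
Variables (F : numFieldType) (sigma : {rmorphism F -> F}).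
Hypotheses (sigmaK : involutive sigma) (sigma_ge0 : forall x, 0 <= sigma x * x).

Definition adjmx m n (A : 'M[F]_(m, n)) : 'M_(n, m) := (map_mx sigma A)^T.

Definition psdmx n (X : 'M[F]_n) : Prop :=
  adjmx X = X /\ forall v : 'cV_n, 0 <= (adjmx v *m X *m v) 0 0.

Lemma adjmxK m n (A : 'M[F]_(m, n)) : adjmx (adjmx A) = A.
Proof. by apply/matrixP=> i j; rewrite !mxE sigmaK. Qed.

Lemma adjmxM m n p (A : 'M[F]_(m, n)) (B : 'M_(n, p)) :
  adjmx (A *m B) = adjmx B *m adjmx A.
Proof. by rewrite /adjmx map_mxM trmx_mul. Qed.

Lemma adjmxD m n (A B : 'M[F]_(m, n)) : adjmx (A + B) = adjmx A + adjmx B.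
Proof. by rewrite /adjmx map_mxD linearD. Qed.

Lemma adjmxB m n (A B : 'M[F]_(m, n)) : adjmx (A - B) = adjmx A - adjmx B.
Proof. by rewrite /adjmx map_mxB linearB. Qed.

Lemma adjmxZ m n c (A : 'M[F]_(m, n)) : adjmx (c *: A) = sigma c *: adjmx A.
Proof. by rewrite /adjmx map_mxZ linearZ. Qed.

Lemma adjmx0 m n : adjmx (0 : 'M_(m, n)) = 0.
Proof. by rewrite /adjmx map_mx0 trmx0. Qed.

Lemma adjmx1 n : adjmx (1%:M : 'M_n) = 1%:M.
Proof. by rewrite /adjmx map_mx1 trmx1. Qed.

Lemma mxtrace_adjmx_ge0 m n (Z : 'M[F]_(m, n)) : 0 <= \tr (adjmx Z *m Z).
Proof.
rewrite /mxtrace sumr_ge0 // => i _; rewrite mxE sumr_ge0 // => j _.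
by rewrite !mxE.
Qed.

Lemma mxtrace_adjmx_eq0 m n (Z : 'M[F]_(m, n)) : \tr (adjmx Z *m Z) = 0 -> Z = 0.
Proof.
rewrite /mxtrace => /eqP; rewrite psumr_eq0; last first.
  by move=> i _; rewrite mxE sumr_ge0 // => j _; rewrite !mxE.
move=> /allP Z0; apply/matrixP=> j i.
have := Z0 i (mem_index_enum _); rewrite mxE /= psumr_eq0; last first.
  by move=> k _; rewrite !mxE.
move=> /allP/(_ j (mem_index_enum _)) /=.
by rewrite !mxE mulf_eq0 fmorph_eq0 orbb => /eqP.
Qed.

Lemma psdmx_congr m n (X : 'M[F]_n) (P : 'M_(n, m)) :
  psdmx X -> psdmx (adjmx P *m X *m P).
Proof.
move=> [Xh X0]; split; first by rewrite !adjmxM adjmxK Xh mulmxA.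
by move=> v; have := X0 (P *m v); rewrite adjmxM !mulmxA.
Qed.

Lemma psdmx_eq0 n (X : 'M[F]_n) :
  psdmx X -> (forall v : 'cV_n, (adjmx v *m X *m v) 0 0 = 0) -> X = 0.
Proof.
move=> [Xh _] X0; apply: mxtrace_adjmx_eq0; rewrite Xh.
suff XX (y : 'cV_n) : (adjmx y *m X *m (X *m y)) 0 0 = 0.
  rewrite /mxtrace big1 // => i _.
  have := XX (delta_mx i 0); rewrite /adjmx map_delta_mx trmx_delta.
  rewrite -rowE -colE mxE => E; rewrite mxE -[RHS]E.
  by apply: eq_bigr => j _; rewrite !mxE.
have mxD (A B : 'M[F]_1) : (A + B) 0 0 = A 0 0 + B 0 0 by rewrite mxE.
(* At [X *m y + y] both cross terms are the squared norm of [X *m y], so one polarization serves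
   every [sigma]. *)
have := X0 (X *m y + y); rewrite adjmxD !mulmxDl !mulmxDr !mxD !X0 adjmxM Xh.
rewrite add0r addr0 !mulmxA -mulr2n => /eqP; rewrite mulrn_eq0 /=.
by move=> /eqP.
Qed.

(** Rank-one squares are split off one at a time. [k] is a mere bound on the rank: the real case
    takes the rank itself, to get a [W] of full row rank, and the complex case takes the size. *)
Lemma psdmx_factor (k n : nat) (X : 'M[F]_n) :
  (forall x, 0 <= x -> exists s, sigma s * s = x) ->
  psdmx X -> (\rank X <= k)%N -> exists W : 'M_(k, n), X = adjmx W *m W.
Proof.
move=> sqrt_sigma; elim: k X => [|k IHk] X psdX rkX.
  by exists 0; rewrite mulmx0; apply/eqP; rewrite -mxrank_eq0 -leqn0.
have [[v qn0]|X0] := pselect (exists v : 'cV_n, (adjmx v *m X *m v) 0 0 <> 0); last first.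
  exists 0; rewrite mulmx0; apply: psdmx_eq0 => // v.
  by apply: contrapT => v0; apply: X0; exists v.
have [Xh X0] := psdX.
set q := (adjmx v *m X *m v) 0 0 in qn0; have {}qn0 : q != 0 by apply/eqP.
have qE : adjmx v *m X *m v = q%:M by rewrite [LHS]mx11_scalar.
have sq : sigma q = q.
  have := congr1 (fun M => adjmx M 0 0) qE.
  by rewrite !adjmxM adjmxK Xh mulmxA qE !mxE mulr1n.
(* Deflation: [X *m P] is psd, kills [v], and differs from [X] by a rank-one square. *)
pose P : 'M_n := 1%:M - q^-1 *: (v *m (adjmx v *m X)).
have XP : X *m P = adjmx P *m X.
  rewrite adjmxB adjmx1 adjmxZ fmorphV sq !adjmxM adjmxK Xh.
  by rewrite mulmxBl mul1mx mulmxBr mulmx1 -scalemxAl -scalemxAr !mulmxA.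
have Pv : P *m v = 0.
  by rewrite mulmxBl mul1mx -scalemxAl -mulmxA qE mul_mx_scalar scalerA mulVf // scale1r subrr.
have psdXP : psdmx (X *m P).
  have <- : adjmx P *m X *m P = X *m P; last exact: psdmx_congr.
  rewrite -XP {2}/P mulmxBr mulmx1 -scalemxAr -!mulmxA (mulmxA P) Pv.
  by rewrite mul0mx mulmx0 scaler0 subr0.
(* If the rank did not drop, [X] would be of the form [Z *m (X *m P)] and kill [v], against
   [q != 0]. *)
have rkXP : (\rank (X *m P) < \rank X)%N.
  rewrite ltn_neqAle mxrankM_maxl andbT; apply: contraNneq qn0 => erk.
  have /submxP[Z EZ] : (X <= X *m P)%MS.
    by rewrite -(mxrank_leqif_sup _) ?erk // XP submxMl.
  by rewrite /q EZ -!mulmxA Pv !mulmx0 mxE.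
have [] := IHk _ psdXP; first by rewrite -ltnS (leq_trans rkXP).
move=> W EW; have [s sE] := sqrt_sigma q (X0 v).
have s0 : s != 0 by apply: contraNneq qn0 => s0; rewrite -sE s0 mulr0.
(* The new row is scaled so that its square is the part removed by deflation. *)
pose V : 'M_(1 + k, n) := col_mx (s^-1 *: (adjmx v *m X)) W.
suff EV : X = adjmx V *m V by exists V.
rewrite /V {1}/adjmx map_col_mx tr_col_mx mul_row_col -!/(adjmx _) -EW.
rewrite adjmxZ adjmxM adjmxK Xh -scalemxAl -scalemxAr scalerA fmorphV -invfM sE.
by rewrite mulmxBr mulmx1 -scalemxAr !mulmxA addrCA subrr addr0.
Qed.

End PsdFactorization.

Lemma psd_real_factor (R : realType) n (X : 'M[R]_n) :
  psd_real X -> exists W : 'M_(\rank X, n), X = W^T *m W.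
Proof.
have adjE m k (Y : 'M[R]_(m, k)) : adjmx idfun Y = Y^T by rewrite /adjmx map_mx_id.
move=> [XT X0]; have ge0 (x : R) : 0 <= idfun x * x by rewrite -expr2 sqr_ge0.
have psdX : psdmx idfun X by split=> [|y]; rewrite adjE.
have sqrtP (x : R) : 0 <= x -> exists s : R, idfun s * s = x.
  by move=> x0; exists (Num.sqrt x); rewrite /= -expr2 sqr_sqrtr.
have [W E] := psdmx_factor (sigma := idfun) (fun=> erefl) ge0 sqrtP psdX (leqnn _).
by exists W; rewrite [LHS]E adjE.
Qed.

(** * Extreme points of the elliptope *)

Lemma quad_form_bound (R : realType) r (Q : 'M[R]_r) (v : 'cV[R]_r) :
  `|(v^T *m Q *m v) 0 0| <= (\sum_i \sum_j `|Q i j|) * (v^T *m v) 0 0.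
Proof.
have vv : (v^T *m v) 0 0 = \sum_k v k 0 ^+ 2.
  by rewrite mxE; apply: eq_bigr => k _; rewrite mxE expr2.
have sq k : v k 0 ^+ 2 <= (v^T *m v) 0 0.
  by rewrite vv (bigD1 k) //= lerDl sumr_ge0 // => i _; rewrite sqr_ge0.
rewrite mxE [X in _ <= X * _]exchange_big /= mulr_suml; apply: (le_trans (ler_norm_sum _ _ _)).
apply: ler_sum => j _; rewrite mxE mulr_suml mulr_suml.
apply: (le_trans (ler_norm_sum _ _ _)); apply: ler_sum => i _.
rewrite mxE -mulrA mulrCA normrM ler_wpM2l // normrM.
have := sq i; have := sq j; rewrite -[v i 0 ^+ 2]real_normK ?num_real //.
rewrite -[v j 0 ^+ 2]real_normK ?num_real //.
(* AM-GM: |v_i v_j| <= (v_i^2 + v_j^2) / 2 <= |v|^2. *)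
by have := sqr_ge0 (`|v i 0| - `|v j 0|); nra.
Qed.

Lemma psd_real_perturb (R : realType) r (Q : 'M[R]_r) :
  Q^T = Q ->
  exists2 e : R, 0 < e & forall s : R, `|s| <= e -> psd_real (1%:M + s *: Q).
Proof.
move=> Qs; set K := \sum_i \sum_j `|Q i j|.
have K0 : 0 <= K by apply: sumr_ge0 => i _; apply: sumr_ge0.
have K1 : 0 < 1 + K by rewrite ltr_wpDr.
(* [K] bounds the form of [Q] on unit vectors; the added 1 keeps the radius positive when
   [Q = 0]. *)
exists (1 + K)^-1 => [|s sK]; first by rewrite invr_gt0.
split; first by rewrite linearD /= trmx1 linearZ /= Qs.
move=> v; have /ler_normlP[qK _] := quad_form_bound (s *: Q) v.
have vv : 0 <= (v^T *m v) 0 0.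
  by rewrite mxE sumr_ge0 // => k _; rewrite mxE -expr2 sqr_ge0.
rewrite mulmxDr mulmx1 mulmxDl mxE -lerBlDr sub0r; apply: (le_trans qK).
rewrite -[leRHS]mul1r ler_wpM2r //.
under eq_bigr do under eq_bigr do rewrite mxE normrM.
under eq_bigr do rewrite -mulr_sumr.
rewrite -mulr_sumr -/K; apply: (le_trans (ler_wpM2r K0 sK)).
by rewrite mulrC ler_pdivrMr // mul1r lerDr.
Qed.

(** For small [e] the two matrices W^T (1 +/- e Q) W lie in the elliptope and have midpoint [Cn], so
    extremality gives W^T Q W = 0. This is the dual form of the spanning property of the w_x
    w_x^T. *)
Lemma extreme_elliptope_gram (R : realType) n r (Cn : 'M[R]_n) (W : 'M[R]_(r, n))
    (Q : 'M[R]_r) :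
  extreme_elliptope Cn -> Cn = W^T *m W -> row_free W -> Q^T = Q ->
  (forall x, (W^T *m Q *m W) x x = 0) -> Q = 0.
Proof.
move=> [[_ Cd] Cext] CW Wfree Qs Q0.
have [e e0 eP] := psd_real_perturb Qs.
pose P s := W^T *m (1%:M + s *: Q) *m W.
have PE s : P s = Cn + s *: (W^T *m Q *m W).
  by rewrite /P mulmxDr mulmx1 mulmxDl -CW -scalemxAr -scalemxAl.
have Pell s : `|s| <= e -> elliptope (P s).
  move=> /eP[Ps P0]; split; first split.
  - by rewrite /P !trmx_mul trmxK Ps mulmxA.
  - by move=> v; have := P0 (W *m v); rewrite trmx_mul /P !mulmxA.
  by move=> i; rewrite PE mxE Cd mxE Q0 mulr0 addr0.
have [|||||PC _] := Cext (P e) (P (- e)) (2^-1).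
- by apply: Pell; rewrite ger0_norm // ltW.
- by apply: Pell; rewrite normrN ger0_norm // ltW.
- by rewrite invr_gt0 ltr0n.
- by rewrite invf_lt1 ?ltr1n ?ltr0n.
- have -> : 1 - 2^-1 = 2^-1 :> R by lra.
  rewrite !PE -scalerDr addrACA scaleNr subrr addr0 -mulr2n -scaler_nat scalerA.
  by rewrite mulVf ?scale1r // pnatr_eq0.
move/eqP: PC; rewrite PE -subr_eq0 addrC addKr scaler_eq0 gt_eqF //= => /eqP WQW.
have /row_freeP[B WB] := Wfree.
have -> : Q = B^T *m (W^T *m Q *m W) *m B.
  by rewrite !mulmxA -trmx_mul WB trmx1 mul1mx -mulmxA WB mulmx1.
by rewrite WQW mulmx0 mul0mx.
Qed.

(** * Hermitian psd matrices and perfect correlation *)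

Section HermitianPsd.

Variable R : realType.
Local Notation C := (R[i]).

Lemma ctrmxM m n p (A : 'M[C]_(m, n)) (B : 'M_(n, p)) :
  ctrmx (A *m B) = ctrmx B *m ctrmx A.
Proof. exact: adjmxM. Qed.

Lemma ctrmxK m n (A : 'M[C]_(m, n)) : ctrmx (ctrmx A) = A.
Proof. exact: (adjmxK (@conjcK R)). Qed.

Lemma ctrmxB m n (A B : 'M[C]_(m, n)) : ctrmx (A - B) = ctrmx A - ctrmx B.
Proof. exact: adjmxB. Qed.

Lemma ctrmx_tens m n p q (A : 'M[C]_(m, n)) (B : 'M[C]_(p, q)) :
  ctrmx (A *t B) = ctrmx A *t ctrmx B.
Proof. by rewrite /ctrmx map_mxT trmx_tens. Qed.

Lemma ctrmx1 n : ctrmx (1%:M : 'M[C]_n) = 1%:M.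
Proof. exact: adjmx1. Qed.

Lemma conjc_mul_ge0 (x : C) : 0 <= conjc x * x.
Proof. by rewrite mulrC -sqr_normc exprn_ge0. Qed.

Lemma herm_psd_factor n (A : 'M[C]_n) :
  herm_psd A -> exists G : 'M_n, A = ctrmx G *m G.
Proof.
move=> psdA; apply: (psdmx_factor (sigma := @conjc R)) => //.
- exact: conjcK.
- exact: conjc_mul_ge0.
- move=> x x0; exists (sqrtc x); rewrite /= -[RHS]sqr_sqrtc expr2.
  by rewrite sqrtc_sqrtr // conjc_real.
exact: rank_leq_row.
Qed.

Lemma herm_psd_congr m n (A : 'M[C]_n) (P : 'M_(n, m)) :
  herm_psd A -> herm_psd (ctrmx P *m A *m P).
Proof. exact: (psdmx_congr (@conjcK R)). Qed.

Lemma herm_psdD n (A B : 'M[C]_n) : herm_psd A -> herm_psd B -> herm_psd (A + B).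
Proof.
move=> [Ah A0] [Bh B0]; split.
  by rewrite [LHS](adjmxD (@conjc R)) [X in X + _]Ah [X in _ + X]Bh.
by move=> v; rewrite mulmxDr mulmxDl mxE addr_ge0.
Qed.

(** With rho = G^* G, the trace is the squared Frobenius norm of X G^*. *)
Lemma mxtrace_psd_ge0 n p (rho : 'M[C]_n) (X : 'M_(p, n)) :
  herm_psd rho -> 0 <= \tr (ctrmx X *m X *m rho).
Proof.
move=> /herm_psd_factor[G ->].
rewrite mulmxA mxtrace_mulC !mulmxA -(mulmxA _ _ (ctrmx G)) -{1}[G]ctrmxK -ctrmxM.
exact/mxtrace_adjmx_ge0/conjc_mul_ge0.
Qed.

Lemma mxtrace_psd_eq0 n p (rho : 'M[C]_n) (X : 'M_(p, n)) :
  herm_psd rho -> \tr (ctrmx X *m X *m rho) = 0 -> X *m rho = 0.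
Proof.
move=> /herm_psd_factor[G ->].
rewrite mulmxA mxtrace_mulC !mulmxA -(mulmxA _ _ (ctrmx G)) -{1}[G]ctrmxK -ctrmxM.
by move=> /(mxtrace_adjmx_eq0 conjc_mul_ge0) XG; rewrite XG mul0mx.
Qed.

(** Measurements need not be projective, so [M - N] need not square to 1; its defect is one of the
    nonnegative terms in the trace identity. *)
Lemma observable_defect_psd n (M N : 'M[C]_n) :
  herm_psd M -> herm_psd N -> M + N = 1%:M ->
  herm_psd (1%:M - (M - N) *m (M - N)).
Proof.
move=> psdM psdN MN1.
have NE : N = 1%:M - M by rewrite -MN1 addrC addKr.
have MN : M *m N = N *m M by rewrite NE mulmxBr mulmxBl mulmx1 mul1mx.
have psdNMN : herm_psd (N *m M *m N).
  by have := herm_psd_congr N psdM; rewrite psdN.1.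
have psdMNM : herm_psd (M *m N *m M).
  by have := herm_psd_congr M psdN; rewrite psdM.1.
(* [1 - (M - N)^2 = 4 M N] since [M + N = 1], and [M N] is a sum of two congruences. *)
have MNE : M *m N = N *m M *m N + M *m N *m M.
  by rewrite -MN -mulmxDr (addrC N) MN1 mulmx1.
have psdMN : herm_psd (M *m N) by rewrite MNE; apply: herm_psdD.
have -> : 1%:M - (M - N) *m (M - N) = (M *m N + M *m N) + (M *m N + M *m N).
  rewrite -[1%:M]mulmx1 -{1 2}MN1 !mulmxDl !mulmxDr !mulNmx !mulmxN -MN !opprD !opprK.
  move: (M *m M) (M *m N) (N *m N) => a b c.
  by apply/matrixP=> i j; rewrite !mxE; ring.
by do ![apply: herm_psdD].
Qed.

Lemma perfect_correlation n (rho u v X Y : 'M[C]_n) :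
  herm_psd rho -> \tr rho = 1 -> ctrmx u = u -> ctrmx v = v -> u *m v = v *m u ->
  1%:M - u *m u = ctrmx X *m X -> 1%:M - v *m v = ctrmx Y *m Y ->
  \tr (u *m v *m rho) = 1 ->
  rho *m u = rho *m v /\ rho *m u *m u = rho.
Proof.
move=> psdr trr uh vh uv EX EY truv.
have adj0 (Z : 'M_n) : Z *m rho = 0 -> rho *m ctrmx Z = 0.
  by move=> Zr; rewrite -[rho]psdr.1 -ctrmxM Zr [LHS](adjmx0 (@conjc R)).
have tu := mxtrace_psd_ge0 X psdr; have tv := mxtrace_psd_ge0 Y psdr.
have tuv := mxtrace_psd_ge0 (u - v) psdr.
have trB (A B : 'M[C]_n) : \tr (A - B) = \tr A - \tr B by apply: raddfB.
have sum0 : \tr (ctrmx (u - v) *m (u - v) *m rho) +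
    (\tr (ctrmx X *m X *m rho) + \tr (ctrmx Y *m Y *m rho)) = 0.
  rewrite -EX -EY ctrmxB uh vh !mulmxBl !mulmxBr -uv !mulmxBl mul1mx.
  move: truv; move: (u *m u *m rho) (u *m v *m rho) (v *m v *m rho) => a b c.
  rewrite !trB trr => ->; move: (\tr a) (\tr c) => s t.
  by rewrite addrACA addNr addr0 -(opprB 1 s) addNr.
have /andP[/eqP tuv0 /andP[/eqP tu0 _]] :
    (\tr (ctrmx (u - v) *m (u - v) *m rho) == 0) &&
    ((\tr (ctrmx X *m X *m rho) == 0) && (\tr (ctrmx Y *m Y *m rho) == 0)).
  by rewrite -(paddr_eq0 tu tv) -(paddr_eq0 tuv (addr_ge0 tu tv)) sum0.
have /adj0 := mxtrace_psd_eq0 psdr tuv0.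
have /adj0 := mxtrace_psd_eq0 psdr tu0.
rewrite ctrmxB uh vh mulmxBr => rX /eqP; rewrite subr_eq0 => /eqP ruv; split=> //.
apply/eqP; rewrite eq_sym -subr_eq0 -{1}[rho]mulmx1 -mulmxA -mulmxBr EX mulmxA rX.
by rewrite mul0mx.
Qed.

End HermitianPsd.

(** Since [W] is real, the condition splits into the real and imaginary parts of [Q]. *)
Lemma complex_quad_inj (R : realType) n r (W : 'M[R]_(r, n)) (Q : 'M[R[i]]_r) :
  (forall Q' : 'M[R]_r, Q'^T = Q' ->
     (forall x, (W^T *m Q' *m W) x x = 0) -> Q' = 0) ->
  Q^T = Q ->
  (forall x, \sum_j (W j x)%:C%C * (\sum_i (W i x)%:C%C * Q i j) = 0) ->
  Q = 0.
Proof.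
move=> Winj Qs Q0.
have part (f : {additive R[i] -> R}) :
    (forall a z, f (a%:C%C * z) = a * f z) -> map_mx f Q = 0.
  move=> fM; apply: Winj => [|x]; first by rewrite map_trmx Qs.
  have := congr1 f (Q0 x); rewrite raddf0 raddf_sum => <-.
  rewrite mxE; apply: eq_bigr => j _; rewrite fM mulrC raddf_sum mxE.
  by congr (_ * _); apply: eq_bigr => i _; rewrite fM !mxE.
have Re0 := part (@complex.Re R); have Im0 := part (@complex.Im R).
apply/matrixP=> i j; rewrite mxE.
have /matrixP/(_ i j) : map_mx (@complex.Re R) Q = 0.
  by apply: Re0 => a [b c] /=; rewrite mul0r subr0.
have /matrixP/(_ i j) : map_mx (@complex.Im R) Q = 0.
  by apply: Im0 => a [b c] /=; rewrite mul0r addr0.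
by rewrite !mxE; case: (Q i j) => b c /= -> ->.
Qed.

(** * Clifford relations after left multiplication by [rho] *)

Section CliffordRelations.

Variables (R : realType) (n r D : nat) (Cn : 'M[R]_n) (W : 'M[R]_(r, n)).
Variables (al : 'M[R]_(n, r)) (rho : 'M[R[i]]_D) (u v : 'I_n -> 'M[R[i]]_D).
Hypotheses (CnW : Cn = W^T *m W) (Wal : W *m al = 1%:M).
Hypothesis diagC : forall x, Cn x x = 1.
Hypothesis Winj : forall Q : 'M[R]_r, Q^T = Q ->
  (forall x, (W^T *m Q *m W) x x = 0) -> Q = 0.
Hypotheses (psdr : herm_psd rho) (uh : forall x, ctrmx (u x) = u x).
Hypothesis uvC : forall x y, u x *m v y = v y *m u x.
Hypothesis ruv : forall x, rho *m u x = rho *m v x.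
Hypothesis ruu : forall x, rho *m u x *m u x = rho.
Hypothesis trC : forall x y, \tr (u x *m v y *m rho) = ((Cn x y)%:C)%C.

(** As [W *m al = 1%:M], column [i] of [al] writes the [i]-th basis vector in the columns of [W];
    [lincomb u i] is thus the operator U_i. *)
Definition lincomb (w : 'I_n -> 'M[R[i]]_D) (i : 'I_r) : 'M_D :=
  \sum_x (al x i)%:C%C *: w x.

Lemma mul_lincomb i : rho *m lincomb u i = rho *m lincomb v i.
Proof.
rewrite !mulmx_sumr; apply: eq_bigr => x _.
by rewrite -!scalemxAr ruv.
Qed.

Lemma lincombC y i : v y *m lincomb u i = lincomb u i *m v y.
Proof.
rewrite mulmx_sumr mulmx_suml; apply: eq_bigr => x _.
by rewrite -scalemxAr -scalemxAl uvC.
Qed.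

(** This makes the extension of w_x |-> u_x well defined: for the combination [X], the trace of X^2
    rho is l^T C l, which vanishes. *)
Lemma null_vector_sum (l : 'cV[R]_n) :
  l^T *m Cn = 0 -> rho *m (\sum_x (l x 0)%:C%C *: u x) = 0.
Proof.
move=> lC; set X := \sum_x _.
have Xh : ctrmx X = X.
  rewrite /ctrmx /X map_mx_sum linear_sum; apply: eq_bigr => x _ /=.
  rewrite map_mxZ linearZ /= -[in RHS]uh; congr (_ *: _); exact: conjc_real.
(* By cyclicity [rho] comes to stand left of [u x] and turns it into [v x]. *)
have truu x y : \tr (u x *m u y *m rho) = (Cn y x)%:C%C.
  by rewrite mxtrace_mulC mulmxA ruv -mulmxA -mxtrace_mulC -uvC trC.
have Xr : X *m rho = 0.
  apply: mxtrace_psd_eq0 => //; rewrite Xh.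
  rewrite -mulmxA mulmx_suml linear_sum big1 // => x _ /=.
  rewrite -scalemxAl linearZ /= mulmx_suml mulmx_sumr linear_sum /=.
  under eq_bigr => y _.
    rewrite -scalemxAl -scalemxAr linearZ /= mulmxA truu -rmorphM /=; over.
  rewrite -rmorph_sum /= (_ : \sum_y l y 0 * Cn y x = (l^T *m Cn) 0 x).
    by rewrite lC mxE mulr0.
  by rewrite mxE; apply: eq_bigr => y _; rewrite mxE.
rewrite -[rho]psdr.1 -[X]Xh -ctrmxM Xr; exact: adjmx0.
Qed.

Lemma mul_u_lincomb y :
  \sum_i (W i y)%:C%C *: (rho *m lincomb u i) = rho *m u y.
Proof.
(* [l] is killed by [W] because [W *m al = 1%:M], hence also by [Cn]. *)
pose l := al *m col y W - delta_mx y 0.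
have /null_vector_sum : l^T *m Cn = 0.
  have Cl : Cn *m l = 0.
    by rewrite CnW -mulmxA mulmxBr mulmxA Wal mul1mx -colE subrr mulmx0.
  have CnT : Cn^T = Cn by rewrite CnW trmx_mul trmxK.
  by rewrite -CnT -trmx_mul Cl trmx0.
rewrite mulmx_sumr => l0.
apply/eqP; rewrite -subr_eq0; apply/eqP; rewrite -[RHS]l0.
under [in RHS]eq_bigr => x _.
  rewrite -scalemxAr !mxE rmorphB /= scalerBl rmorph_sum scaler_suml /=; over.
rewrite big_split /= sumrN; congr (_ - _).
  rewrite exchange_big; apply: eq_bigr => i _ /=.
  rewrite mulmx_sumr scaler_sumr; apply: eq_bigr => x _.
  by rewrite -scalemxAr scalerA !mxE rmorphM mulrC.
rewrite (bigD1 y) //= !eqxx rmorph1 scale1r big1 ?addr0 // => x /negbTE ->.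
by rewrite rmorph0 scale0r.
Qed.

(** Summing over [i] yields rho u_y = rho v_y; then v_y commutes past the second combination, which
    again stands next to [rho] and can be summed. *)
Lemma mul_u2_lincomb y :
  \sum_j (W j y)%:C%C *:
    (\sum_i (W i y)%:C%C *: (rho *m lincomb u i *m lincomb u j)) = rho.
Proof.
under eq_bigr => j _.
  under eq_bigr do rewrite scalemxAl.
  rewrite -mulmx_suml mul_u_lincomb ruv -mulmxA lincombC mulmxA scalemxAl; over.
by rewrite -mulmx_suml mul_u_lincomb -mulmxA uvC mulmxA -ruv ruu.
Qed.

Lemma lincomb_clifford i j :
  rho *m (lincomb u i *m lincomb u j + lincomb u j *m lincomb u i) =
    (2 * (i == j)%:R) *: rho.
Proof.
apply/matrixP=> k l.
pose P i j := (rho *m lincomb u i *m lincomb u j) k l.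
(* At a fixed entry [k], [l], the Clifford defects form a symmetric matrix of scalars, to be killed
   by its values at the w_y. *)
pose Q := \matrix_(i, j) (P i j + P j i - (2 * (i == j)%:R) * rho k l).
suff Q0 : Q = 0.
  have /eqP : P i j + P j i - (2 * (i == j)%:R) * rho k l = 0.
    by move/matrixP: Q0 => /(_ i j); rewrite !mxE.
  by rewrite subr_eq0 mulmxDr !mulmxA [LHS]mxE [RHS]mxE => /eqP.
apply: (complex_quad_inj Winj) => [|y].
  by apply/matrixP=> a b; rewrite !mxE eq_sym [P b a + _]addrC.
have sumP : \sum_j (W j y)%:C%C * (\sum_i (W i y)%:C%C * P i j) = rho k l.
  rewrite -[in RHS](mul_u2_lincomb y) summxE; apply: eq_bigr => b _.
  rewrite mxE summxE; congr (_ * _); apply: eq_bigr => a _.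
  by rewrite mxE.
have sumPt : \sum_j (W j y)%:C%C * (\sum_i (W i y)%:C%C * P j i) = rho k l.
  rewrite -[RHS]sumP; under eq_bigr do rewrite mulr_sumr.
  rewrite exchange_big; apply: eq_bigr => b _ /=; rewrite mulr_sumr.
  by apply: eq_bigr => a _; rewrite mulrCA.
(* The Kronecker term contributes |w_y|^2 = [Cn y y] = 1. *)
have sumd : \sum_j (W j y)%:C%C * (\sum_i (W i y)%:C%C * ((2 * (i == j)%:R) * rho k l))
    = 2 * rho k l.
  transitivity (\sum_j (W j y * W j y)%:C%C * (2 * rho k l)).
    apply: eq_bigr => b _; rewrite (bigD1 b) //= eqxx mulr1 big1 ?addr0.
      by rewrite rmorphM mulrA.
    by move=> a /negbTE ->; rewrite mulr0 mul0r mulr0.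
  rewrite -mulr_suml -rmorph_sum /= [X in X%:C%C](_ : _ = Cn y y).
    by rewrite diagC mul1r.
  by rewrite CnW mxE; apply: eq_bigr => b _; rewrite mxE.
transitivity (rho k l + rho k l - 2 * rho k l); last first.
  by rewrite mulr_natl mulr2n subrr.
rewrite -{1}sumP -{1}sumPt -sumd -big_split -sumrB; apply: eq_bigr => b _.
rewrite /= -mulrDr -mulrBr -big_split -sumrB; congr (_ * _).
by apply: eq_bigr => a _; rewrite /= mxE -mulrDr -mulrBr.
Qed.

End CliffordRelations.

(** * Kronecker products *)

Section Tensor.

Variable K : comPzRingType.

Lemma tensmxBl m n p q (A B : 'M[K]_(m, n)) (Y : 'M[K]_(p, q)) :
  (A - B) *t Y = A *t Y - B *t Y.
Proof. by apply/matrixP=> i j; rewrite !mxE mulrBl. Qed.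

Lemma tensmxBr m n p q (A : 'M[K]_(m, n)) (X Y : 'M[K]_(p, q)) :
  A *t (X - Y) = A *t X - A *t Y.
Proof. by apply/matrixP=> i j; rewrite !mxE mulrBr. Qed.

Lemma tensmxZr m n p q c (A : 'M[K]_(m, n)) (Y : 'M[K]_(p, q)) :
  A *t (c *: Y) = c *: (A *t Y).
Proof. by apply/matrixP=> i j; rewrite !mxE mulrCA. Qed.

Lemma tensmxZl m n p q c (A : 'M[K]_(m, n)) (Y : 'M[K]_(p, q)) :
  (c *: A) *t Y = c *: (A *t Y).
Proof. by apply/matrixP=> i j; rewrite !mxE mulrA. Qed.

Lemma tensmx_suml m n p q (I : finType) (A : I -> 'M[K]_(m, n)) (Y : 'M[K]_(p, q)) :
  (\sum_i A i) *t Y = \sum_i A i *t Y.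
Proof.
apply/matrixP=> i j; rewrite mxE !summxE mulr_suml.
by apply: eq_bigr => k _; rewrite mxE.
Qed.

Lemma tensmx_sumr m n p q (I : finType) (A : 'M[K]_(m, n)) (Y : I -> 'M[K]_(p, q)) :
  A *t (\sum_i Y i) = \sum_i A *t Y i.
Proof.
apply/matrixP=> i j; rewrite mxE !summxE mulr_sumr.
by apply: eq_bigr => k _; rewrite mxE.
Qed.

Lemma tensmx11 m n : (1%:M : 'M[K]_m) *t (1%:M : 'M[K]_n) = 1%:M.
Proof.
apply/matrixP=> i j; case: (mxtens_indexP i) => a b; case: (mxtens_indexP j) => a' b'.
rewrite tensmxE !mxE -natrM mulnb; congr (nat_of_bool _)%:R.
by rewrite (can_eq (@mxtens_indexK m n)).
Qed.

End Tensor.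

(** * The right module generated by [rho] *)

Section RightOrbit.

Variables (R : realType) (d : nat) (rho : 'M[R[i]]_(d * d)).

(** By linearity in [Y], the matrix units suffice to span the rows of every [rho *m (1%:M *t Y)]. *)
Definition right_orbit : 'M[R[i]]_(d * d) :=
  (\sum_(ij : 'I_d * 'I_d) rho *m (1%:M *t delta_mx ij.1 ij.2))%MS.

Lemma right_orbit_sup (Y : 'M[R[i]]_d) : (rho *m (1%:M *t Y) <= right_orbit)%MS.
Proof.
rewrite [Y]matrix_sum_delta tensmx_sumr mulmx_sumr summx_sub // => i _.
rewrite tensmx_sumr mulmx_sumr summx_sub // => j _.
rewrite tensmxZr -scalemxAr scalemx_sub //.
by apply: (sumsmx_sup (i, j)).
Qed.

Lemma right_orbitM (T B : 'M[R[i]]_(d * d)) :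
  (forall Y : 'M[R[i]]_d, (rho *m (1%:M *t Y) *m T <= B)%MS) ->
  (right_orbit *m T <= B)%MS.
Proof.
move=> TB; rewrite sumsmxMr; apply/sumsmx_subP=> -[i j] _; exact: TB.
Qed.

End RightOrbit.

(** Stability of the orbit: [A i] commutes past [Y] to reach [rho], where it becomes [B i] and is
    absorbed into [Y]. The relations extend to the orbit because anticommutators of the [A i]
    commute with [Y] too. *)
Lemma clifford_dim_tensor (R : realType) (d m : nat) (rho : 'M[R[i]]_(d * d))
    (A B : nat -> 'M[R[i]]_d) :
  rho != 0 ->
  (forall i, (i < m.*2)%N -> rho *m (A i *t 1%:M) = rho *m (1%:M *t B i)) ->
  (forall i j, (i < m.*2)%N -> (j < m.*2)%N ->
     rho *m ((A i *t 1%:M) *m (A j *t 1%:M) + (A j *t 1%:M) *m (A i *t 1%:M)) =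
       (2 * (i == j)%:R) *: rho) ->
  (2 ^ m <= d * d)%N.
Proof.
move=> rho0 rAB rel.
have C Y i : (1%:M *t Y) *m (A i *t 1%:M) = (A i *t 1%:M) *m (1%:M *t Y).
  by rewrite !tensmx_mul !mul1mx !mulmx1.
apply: leq_trans (rank_leq_row (right_orbit rho)).
apply: (@clifford_rank _ _ _ (fun i => A i *t 1%:M)) => [|i im|i j im jm].
- apply: contraNneq rho0 => S0; have := right_orbit_sup rho 1%:M.
  by rewrite tensmx11 mulmx1 S0 submx0.
- apply: right_orbitM => Y; rewrite -mulmxA C mulmxA rAB // -mulmxA tensmx_mul mul1mx.
  exact: right_orbit_sup.
set T := _ + _; have CT Y : (1%:M *t Y) *m T = T *m (1%:M *t Y).
  by rewrite mulmxDl mulmxDr !mulmxA !C -!mulmxA !C.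
(* The relation is recast as right multiplication by a single matrix, so that [right_orbitM] applies
   with target 0. *)
apply/eqP; rewrite -subr_eq0 -mul_mx_scalar -mulmxBr -submx0.
apply: right_orbitM => Y.
rewrite mulmxBr mul_mx_scalar -mulmxA CT mulmxA rel // -scalemxAl subrr.
exact: sub0mx.
Qed.

(** * From measurements to observables, and the dimension bound *)

Section QuantumModel.

Variables (R : realType) (n d : nat) (Cn : 'M[R]_n).
Variables (rho : 'M[R[i]]_(d * d)) (M N : 'I_n -> bool -> 'M[R[i]]_d).
Hypothesis tr_model : forall a b x y,
  \tr ((M x a *t N y b) *m rho) = ((pC Cn a b x y)%:C)%C.

Lemma correlator x y :
  \tr (((M x false - M x true) *t (N y false - N y true)) *m rho) = (Cn x y)%:C%C.
Proof.
have trB (A B : 'M[R[i]]_(d * d)) : \tr (A - B) = \tr A - \tr B by apply: raddfB.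
rewrite tensmxBl !tensmxBr !mulmxBl.
have := tr_model true true x y; have := tr_model true false x y.
have := tr_model false true x y; have := tr_model false false x y.
move: (M x false *t N y false *m rho) (M x false *t N y true *m rho).
move: (M x true *t N y false *m rho) (M x true *t N y true *m rho).
move=> a b c e; rewrite !trB => -> -> -> ->; rewrite -!rmorphB /=; congr (_%:C)%C.
by rewrite /pC /sgn /= !expr0 !expr1; field.
Qed.

End QuantumModel.

Lemma observable_tens (R : realType) d (M N : 'M[R[i]]_d) :
  herm_psd M -> herm_psd N -> M + N = 1%:M ->
  [/\ ctrmx (M - N) = M - N,
      exists X : 'M_(d * d), 1%:M - ((M - N) *t 1%:M) *m ((M - N) *t 1%:M) =
        ctrmx X *m X :> 'M_(d * d) &
      exists X : 'M_(d * d), 1%:M - (1%:M *t (M - N)) *m (1%:M *t (M - N)) =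
        ctrmx X *m X :> 'M_(d * d)].
Proof.
move=> psdM psdN MN1; split; first by rewrite ctrmxB psdM.1 psdN.1.
  have [X EX] := herm_psd_factor (observable_defect_psd psdM psdN MN1).
  exists (X *t 1%:M); rewrite ctrmx_tens ctrmx1 !tensmx_mul -EX mulmx1.
  by rewrite tensmxBl tensmx11.
have [X EX] := herm_psd_factor (observable_defect_psd psdM psdN MN1).
exists (1%:M *t X); rewrite ctrmx_tens ctrmx1 !tensmx_mul -EX mulmx1.
by rewrite tensmxBr tensmx11.
Qed.

(* D(p_{C_n}) >= sqrt(2)^floor(r_max(n)/2): every d admitting a
   d-dimensional quantum representation of p_{C_n} satisfies the bound. *)
Theorem theorem5p14 (R : realType) (n : nat) (Cn : 'M[R]_n) :
  (1 <= n)%N ->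
  extreme_elliptope Cn ->
  \rank Cn = rmax R n ->
  forall d : nat, has_qrep (pC Cn) d ->
    Num.sqrt (2 : R) ^+ (rmax R n)./2 <= d%:R.
Proof.
move=> _ extC rkC d [rho [M [N [[psdr trr] [psdM M1] [psdN N1] trC]]]].
rewrite -rkC; set r := \rank Cn.
have [[psdC diagC] _] := extC.
have [W CW] : exists W : 'M[R]_(r, n), Cn = W^T *m W by apply: psd_real_factor.
(* [W] has [\rank Cn] rows, and its rank is at least that of W^T W. *)
have Wfree : row_free W.
  by rewrite -row_leq_rank {1}/r CW mxrankM_maxr.
have [al Wal] := row_freeP Wfree.
pose A x := M x false - M x true; pose B y := N y false - N y true.
pose u x : 'M_(d * d) := A x *t 1%:M; pose v y : 'M_(d * d) := 1%:M *t B y.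
have trAB x y : \tr (u x *m v y *m rho) = ((Cn x y)%:C)%C.
  rewrite tensmx_mul mulmx1 mul1mx; exact: (correlator trC).
have uvC x y : u x *m v y = v y *m u x by rewrite !tensmx_mul !mulmx1 !mul1mx.
have obsA x := observable_tens (psdM x false) (psdM x true) (M1 x).
have obsB x := observable_tens (psdN x false) (psdN x true) (N1 x).
have uh x : ctrmx (u x) = u x by have [Ah _ _] := obsA x; rewrite ctrmx_tens Ah ctrmx1.
have vh x : ctrmx (v x) = v x by have [Bh _ _] := obsB x; rewrite ctrmx_tens Bh ctrmx1.
have corr x : rho *m u x = rho *m v x /\ rho *m u x *m u x = rho.
  have [_ [X EX] _] := obsA x; have [_ _ [Y EY]] := obsB x.
  by apply: (perfect_correlation psdr trr (uh x) (vh x) (uvC x x) EX EY); rewrite trAB diagC.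
have ruv x := (corr x).1; have ruu x := (corr x).2.
have Winj := extreme_elliptope_gram extC CW Wfree.
have rel := lincomb_clifford CW Wal diagC (fun Q => Winj Q) psdr uh uvC ruv ruu trAB.
(* [clifford_dim_tensor] indexes generators by [nat], so the family is padded with 0. *)
pose ext (c : 'I_n -> 'M[R[i]]_d) (i : nat) : 'M_d :=
  if insub i is Some k then \sum_x (al x (k : 'I_r))%:C%C *: c x else 0.
(* An even number of generators is kept; for odd [r] the last one is dropped. *)
have lt_r i : (i < r./2.*2)%N -> (i < r)%N.
  by move=> im; apply: leq_trans im _; rewrite -{2}(odd_double_half r) leq_addl.
have extA i (im : (i < r)%N) : ext A i *t 1%:M = lincomb al u (Ordinal im).
  rewrite /ext insubT tensmx_suml; apply: eq_bigr => x _.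
  by rewrite tensmxZl.
have extB i (im : (i < r)%N) : 1%:M *t ext B i = lincomb al v (Ordinal im).
  rewrite /ext insubT tensmx_sumr; apply: eq_bigr => x _.
  by rewrite tensmxZr.
have d2 : (2 ^ r./2 <= d * d)%N.
  apply: (@clifford_dim_tensor _ _ _ rho (ext A) (ext B)).
  - by apply/eqP=> r0; move: trr; rewrite r0 mxtrace0 => /eqP; rewrite eq_sym oner_eq0.
  - move=> i /lt_r im; rewrite extA extB; exact: mul_lincomb.
  - move=> i j /lt_r im /lt_r jm; rewrite !extA; exact: rel.
(* Both sides are nonnegative, so it suffices to compare their squares. *)
rewrite -(ler_pXn2r (ltn0Sn 1)) ?nnegrE ?exprn_ge0 ?sqrtr_ge0 ?ler0n //.
rewrite -exprM mulnC exprM sqr_sqrtr ?ler0n // -!natrX ler_nat expnS expn1.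
by rewrite mulnn -mulnn.
Qed.
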